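(* Let $d\geq2$, let $\alpha_0=\alpha_0(d)>0$, and let $X\subseteq\mathbb{R}^d$ be a separated net such that $X$ is $\omega$-irregular for any modulus of continuity $\omega$ for which there is $a>0$ with $\omega(t)=t\bigl(\log\frac1t\bigr)^{\alpha_0}$ for all $t\in(0,a)$. Then for any bijection $f\colon X\to\mathbb{Z}^d$, $$\limsup_{R\to\infty}\ \sup_{x\in B(\mathbf{0},R)\cap X}\frac{\|f(x)-x\|_2}{(\log R)^{\alpha_0}}=\infty .$$
   Context: A set $A\subseteq\mathbb{R}^d$ is a separated net (of $\mathbb{R}^d$) if there are $r,s>0$ such that $\|x-y\|_2\geq s$ for all distinct $x,y\in A$ and $\operatorname{dist}(z,A)\leq r$ for all $z\in\mathbb{R}^d$. A modulus of continuity is a strictly increasing, concave function $\omega\colon(0,a)\to(0,\infty)$ (for some $a>0$) with $\lim_{t\to0}\omega(t)=0$. Convention: any condition involving a value of $\omega$ is imposed only when the argument lies in the domain of $\omega$ (the condition is void otherwise). Given separated nets $X,Y\subseteq\mathbb{R}^d$ and a modulus of continuity $\omega$, a mapping $f\colon X\to Y$ is a homogeneous $\omega$-mapping if there are constants $K>0$ and $a\in(0,1)$ such that $$\|f(x_2)-f(x_1)\|_2\leq KR\,\omega\left(\frac{\|x_2-x_1\|_2}{R}\right)$$ for all $R>0$ and all (distinct) $x_1,x_2\in X\cap B(\mathbf{0},R)$ with $\|x_2-x_1\|_2<aR$, where $B(\mathbf{0},R)$ is the open Euclidean ball. The net $X$ is $\omega$-regular with respect to $Y$ if there is a bijection $f\colon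 X\to Y$ such that both $f$ and $f^{-1}$ are homogeneous $\omega$-mappings; otherwise $X$ is $\omega$-irregular with respect to $Y$. When $Y=\mathbb{Z}^d$ one just says $\omega$-regular or $\omega$-irregular. *)

(* Defs.v *)
From mathcomp Require Import all_boot all_order all_algebra.
From mathcomp Require Import all_classical all_reals all_analysis.

Set Implicit Arguments.
Unset Strict Implicit.
Unset Printing Implicit Defensive.

Import Order.TTheory GRing.Theory Num.Theory.
Import numFieldNormedType.Exports.

Local Open Scope classical_set_scope.
Local Open Scope ring_scope.

Section definitions.
Variables (R : realType) (d : nat).
Implicit Types (X Y : set 'rV[R]_d) (f : 'rV[R]_d -> 'rV[R]_d).

(* The library norm on ['rV[R]_d] is the sup norm, hence this definition. *)
Definition norm2 (x : 'rV[R]_d) : R := Num.sqrt (\sum_(i < d) x ord0 i ^+ 2).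

Definition ball2 (r : R) : set 'rV[R]_d := [set x | norm2 x < r].

(* Extended-real infimum, so that the distance to the empty set is [+oo]. *)
Definition dist2 (z : 'rV[R]_d) (A : set 'rV[R]_d) : \bar R :=
  ereal_inf [set (norm2 (z - x))%:E | x in A].

Definition separated_net (A : set 'rV[R]_d) : Prop :=
  exists r s : R, [/\ 0 < r, 0 < s,
    forall x y, A x -> A y -> x != y -> s <= norm2 (x - y) &
    forall z, (dist2 z A <= r%:E)%E].

Definition integer_lattice : set 'rV[R]_d :=
  [set x | forall i, x ord0 i \is a Num.int].

(* A modulus with domain ]0, b[ is the pair of [b] and a total function [w],
   whose values outside ]0, b[ are never used. *)
Definition modulus_of_continuity (b : R) (w : R -> R) : Prop :=
  [/\ 0 < b,
      forall t, 0 < t < b -> 0 < w t,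
      {in `]0, b[ &, {homo w : s t / s < t}},
      @convex_function R R^o `]0, b[ (\- w) &
      w t @[t --> 0^'+] --> 0].

(* [f] is only evaluated on [X]; the bound is void when the argument of [w]
   is not in ]0, b[. *)
Definition homogeneous_mapping (b : R) (w : R -> R) X f : Prop :=
  exists K a : R, [/\ 0 < K, 0 < a < 1 &
    forall (r : R) (x1 x2 : 'rV[R]_d), 0 < r ->
      (X `&` ball2 r) x1 -> (X `&` ball2 r) x2 -> x1 != x2 ->
      norm2 (x2 - x1) < a * r ->
      norm2 (x2 - x1) / r < b ->
      norm2 (f x2 - f x1) <= K * r * w (norm2 (x2 - x1) / r)].

(* ['pinv_(fun=> 0) X f] is the inverse on [Y] of the bijection [f] from [X]
   to [Y]. *)
Definition regular_wrt (b : R) (w : R -> R) X Y : Prop :=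
  exists f, [/\ set_bij X Y f,
    homogeneous_mapping b w X f &
    homogeneous_mapping b w Y ('pinv_(fun=> 0) X f)].

Definition irregular_wrt (b : R) (w : R -> R) X Y : Prop :=
  ~ regular_wrt b w X Y.

End definitions.

Arguments integer_lattice : clear implicits.

(* Main.v *)
(** If the limsup is finite, then [|f x - x| <= C (ln r)^alpha0] for all large
    [r] and all [x] in [X] of norm less than [r], and [f^-1] satisfies a
    similar bound. Two distinct points at distance [D] have images at distance
    at most [D + 2 C (ln r)^alpha0]. Since [D] is bounded below by the
    separation constant, this is at most a constant times [D (ln (r /
    D))^alpha0] as soon as [r / D] is large. The domain ]0, b[ of the modulus
    may be chosen as small as needed, which forces both [r / D] and [r] to be
    large, so [f] is a regularity witness, contradicting irregularity. *)

Require Import Defs.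
From mathcomp Require Import all_boot all_order all_algebra.
From mathcomp Require Import all_classical all_reals all_analysis.
From mathcomp Require Import ring lra.

Import Order.TTheory GRing.Theory Num.Theory.
Import numFieldNormedType.Exports.

Local Open Scope classical_set_scope.
Local Open Scope ring_scope.

(** * The Euclidean norm and the separation of the integer lattice *)

Section norm2.
Context {R : realType} {d : nat}.
Implicit Types x y z : 'rV[R]_d.

Lemma norm2_ge0 x : 0 <= norm2 x.
Proof. exact: sqrtr_ge0. Qed.

Lemma sqr_norm2 x : norm2 x ^+ 2 = \sum_(i < d) x ord0 i ^+ 2.
Proof. by rewrite sqr_sqrtr// sumr_ge0// => i _; exact: sqr_ge0. Qed.

Lemma norm2N x : norm2 (- x) = norm2 x.
Proof. by rewrite /norm2; under eq_bigr do rewrite mxE sqrrN. Qed.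

Lemma norm2B x y : norm2 (x - y) = norm2 (y - x).
Proof. by rewrite -norm2N opprB. Qed.

Lemma norm2_eq0 x : norm2 x = 0 -> x = 0.
Proof.
move=> x0; have /eqP : \sum_(i < d) x ord0 i ^+ 2 = 0.
  by rewrite -sqr_norm2 x0 expr0n.
rewrite psumr_eq0 => [/allP xi0|i _]; last exact: sqr_ge0.
apply/rowP => i; rewrite mxE; apply/eqP.
by rewrite -sqrf_eq0; apply: xi0; rewrite mem_index_enum.
Qed.

Lemma ler_norm2D x y : norm2 (x + y) <= norm2 x + norm2 y.
Proof.
have [/norm2_eq0 ->|x0] := eqVneq (norm2 x) 0.
  by rewrite add0r lerDr norm2_ge0.
have [/norm2_eq0 ->|y0] := eqVneq (norm2 y) 0.
  by rewrite addr0 lerDl norm2_ge0.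
have nx : 0 < norm2 x by rewrite lt_def x0 norm2_ge0.
have ny : 0 < norm2 y by rewrite lt_def y0 norm2_ge0.
rewrite -(ler_pXn2r (n := 2))// ?nnegrE ?addr_ge0 ?norm2_ge0//.
(* Weighting by the norms makes the inequality hold coordinatewise, which
   avoids Cauchy-Schwarz. *)
have -> : (norm2 x + norm2 y) ^+ 2 = (norm2 x + norm2 y) *
    (norm2 x ^+ 2 / norm2 x + norm2 y ^+ 2 / norm2 y) by field; rewrite y0.
rewrite !sqr_norm2 !mulr_suml -big_split mulr_sumr/=.
apply: ler_sum => i _; rewrite mxE.
move: (x ord0 i) (y ord0 i) => a b; rewrite -subr_ge0.
have -> : (norm2 x + norm2 y) * (a ^+ 2 / norm2 x + b ^+ 2 / norm2 y) -
    (a + b) ^+ 2 = (norm2 y * a - norm2 x * b) ^+ 2 / (norm2 x * norm2 y).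
  by field; rewrite x0 y0.
by rewrite divr_ge0 ?sqr_ge0// mulr_ge0 ?norm2_ge0.
Qed.

Lemma ler_dist2D z x y : norm2 (x - y) <= norm2 (x - z) + norm2 (z - y).
Proof. by have := ler_norm2D (x - z) (z - y); rewrite addrA subrK. Qed.

Lemma integer_lattice_separated x y :
  integer_lattice R d x -> integer_lattice R d y -> x != y ->
  1 <= norm2 (x - y).
Proof.
move=> xZ yZ; have [[i xyi]|xy] := pselect (exists i, x ord0 i != y ord0 i).
  move=> _; rewrite -(ler_pXn2r (n := 2))// ?nnegrE ?norm2_ge0//.
  rewrite expr1n sqr_norm2 (bigD1 i)//= -[leLHS]addr0 lerD//.
    by rewrite !mxE sqr_intr_ge1 ?rpredB// subr_eq0.
  by rewrite sumr_ge0// => j _; exact: sqr_ge0.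
move=> /eqP[]; apply/rowP => i; apply/eqP/negPn/negP => xyi.
by apply: xy; exists i.
Qed.

End norm2.

(** * A convexity criterion and the growth of powers of the logarithm *)

Section real.
Context {R : realType}.
Implicit Types x y s t a b : R.

(** The mean value theorem on both sides of an interior convex combination [z] of [x < y] gives two
    slopes [df c1 <= df c2], and the convexity defect is a nonnegative multiple of their
    difference. *)
Lemma convex_function_derive (f df : R -> R) a b :
  {in `]a, b[, forall x, is_derive x 1 f (df x)} ->
  {in `]a, b[ &, {homo df : x y / x <= y}} ->
  @convex_function R R^o `]a, b[ f.
Proof.
move=> fdf dfh p.
have key (q : {i01 R}) x y : x \in `]a, b[ -> y \in `]a, b[ -> x < y ->
    f (q%:num * x + (1 - q%:num) * y) <= q%:num * f x + (1 - q%:num) * f y.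
  rewrite !in_itv/= => /andP[ax xb] /andP[ay yb] xy.
  have [q0 q1] : 0 <= q%:num /\ q%:num <= 1 by [].
  move: (q%:num) q0 q1 => {}q q0 q1.
  have [->|q00] := eqVneq q 0; first by rewrite subr0 !mul0r !add0r !mul1r.
  have [->|q11] := eqVneq q 1; first by rewrite subrr !mul0r !addr0 !mul1r.
  have {q00}q0 : 0 < q by rewrite lt_def q00.
  have {q11}q1 : q < 1 by rewrite lt_def eq_sym q11.
  set z := q * x + (1 - q) * y.
  have xz : x < z by rewrite /z; nra.
  have zy : z < y by rewrite /z; nra.
  have slope u v : a < u -> v < b -> u < v ->
      exists2 c, u < c < v & f v - f u = df c * (v - u).
    move=> au vb uv.
    have [||c] := @MVT R f df u v uv.
    - move=> w; rewrite in_itv/= => /andP[uw wv]; apply: fdf.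
      by rewrite in_itv/= (lt_trans au uw) (lt_trans wv vb).
    - apply: derivable_within_continuous => w.
      rewrite in_itv/= => /andP[uw wv]; apply: ex_derive; apply: fdf.
      by rewrite in_itv/= (lt_le_trans au uw) (le_lt_trans wv vb).
    - by rewrite in_itv/=; exists c.
  have [c1 /andP[c1x c1z] e1] := slope x z ax (lt_trans zy yb) xz.
  have [c2 /andP[c2x c2z] e2] := slope z y (lt_trans ax xz) yb zy.
  have h : df c1 <= df c2.
    apply: dfh; rewrite ?in_itv/=; last lra.
      by apply/andP; split; lra.
    by apply/andP; split; lra.
  have -> : q * f x + (1 - q) * f y = f z +
     ((1 - q) * (f y - f z) - q * (f z - f x)) by ring.
  rewrite e1 e2 lerDl.
  have -> : (1 - q) * (df c2 * (y - z)) - q * (df c1 * (z - x)) =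
    (df c2 - df c1) * (q * (1 - q) * (y - x)) by rewrite /z; ring.
  by rewrite mulr_ge0 ?subr_ge0// !mulr_ge0; lra.
move=> x y; rewrite !inE => xab yab.
have [xy|yx|->] := ltgtP x y.
- exact: key.
- by rewrite convC [leRHS]convC; exact: key.
- by rewrite !convmm.
Qed.

Lemma powR_ln_le alpha x : 0 < alpha -> 1 <= x ->
  (1 + ln x) `^ alpha <= (1 + alpha) `^ alpha * x.
Proof.
move=> a0 x1; have x0 : 0 < x by lra.
have y0 : 0 < x `^ alpha^-1 by exact: powR_gt0.
have y1 : 1 <= x `^ alpha^-1.
  by rewrite -(powRr0 x) ler_powR// invr_ge0 ltW.
have {2}-> : x = (x `^ alpha^-1) `^ alpha.
  by rewrite -powRrM mulVf ?lt0r_neq0// powRr1// ltW.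
rewrite -powRM; [|lra|exact: ltW].
apply: ge0_ler_powR; rewrite ?nnegrE ?(ltW a0)//.
- by rewrite addr_ge0// ln_ge0.
- by rewrite mulr_ge0 ?(ltW y0)//; lra.
have := ln_sublinear y0; rewrite ln_powR ltr_pdivrMl// => h.
by rewrite mulrDl mul1r; lra.
Qed.

(** This is the previous bound at [Num.sqrt x], since [ln x] is twice the logarithm of the root. The
    gain from [x] to its root yields both sublinearity at infinity and the limit of the modulus at
    0. *)
Lemma powR_ln_le_sqrt alpha x : 0 < alpha -> 1 <= x ->
  ln x `^ alpha <= 2 `^ alpha * (1 + alpha) `^ alpha * Num.sqrt x.
Proof.
move=> a0 x1; have x0 : 0 < x by lra.
have s1 : 1 <= Num.sqrt x by rewrite -sqrtr1 ler_wsqrtr.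
rewrite -mulrA; apply: le_trans; last first.
  by apply: ler_wpM2l; [exact: powR_ge0|exact: powR_ln_le].
rewrite -powRM ?addr_ge0 ?ln_ge0//.
apply: ge0_ler_powR; rewrite ?nnegrE ?(ltW a0) ?ln_ge0//.
  by rewrite mulr_ge0 ?addr_ge0 ?ln_ge0.
rewrite -[in leLHS](sqr_sqrtr (ltW x0)) lnXn ?(lt_le_trans ltr01)//.
by rewrite mulr2n; lra.
Qed.

Lemma powR_ln_sublinear alpha e : 0 < alpha -> 0 < e ->
  exists2 x0, 1 <= x0 & forall x, x0 <= x -> ln x `^ alpha <= e * x.
Proof.
move=> a0 e0; set M := 2 `^ alpha * (1 + alpha) `^ alpha.
have M0 : 0 <= M by rewrite mulr_ge0 ?powR_ge0.
(* Beyond [(M / e) ^+ 2] one has [M <= e * Num.sqrt x], hence [M * Num.sqrt x <= e * x]. *)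
exists (1 + (M / e) ^+ 2) => [|x]; first by rewrite lerDl sqr_ge0.
move=> xM; have x1 : 1 <= x by have := sqr_ge0 (M / e); lra.
apply: (le_trans (powR_ln_le_sqrt _ _ a0 x1)).
have x0 : 0 <= x by lra.
rewrite -[in leRHS](sqr_sqrtr x0) expr2 mulrA ler_wpM2r ?sqrtr_ge0//.
rewrite [leRHS]mulrC -ler_pdivrMr//.
have -> : M / e = Num.sqrt ((M / e) ^+ 2).
  by rewrite sqrtr_sqr ger0_norm// divr_ge0// ltW.
by rewrite ler_wsqrtr//; lra.
Qed.

Definition tlog alpha t := t * ln (1 / t) `^ alpha.

Definition dtlog alpha t :=
  ln (1 / t) `^ alpha - alpha * ln (1 / t) `^ (alpha - 1).

Lemma gt_ln_inv c t : 0 < t < expR (- c) -> c < ln (1 / t).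
Proof.
move=> /andP[t0 tc]; rewrite div1r lnV ?posrE// ltrNr -[ltRHS]expRK.
by rewrite ltr_ln ?posrE ?expR_gt0.
Qed.

Lemma is_derive_tlog alpha t : 0 < t < 1 ->
  is_derive t 1 (tlog alpha) (dtlog alpha t).
Proof.
move=> /andP[t0 t1].
(* Since [ln] is 0 on nonpositive reals, the identity holds for every [u], so the two functions are
   equal globally. *)
have lnV1 (u : R) : ln (1 / u) = - ln u.
  rewrite div1r; have [u0|u0] := ltP 0 u; first by rewrite lnV.
  by rewrite !ln0 ?oppr0// invr_le0.
have -> : tlog alpha = fun u => u * (- ln u) `^ alpha.
  by apply/funext => u; rewrite /tlog lnV1.
rewrite /dtlog lnV1.
have L0 : 0 < - ln t by rewrite oppr_gt0 ln_lt0// t0.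
have dp := is_derive1_powR alpha L0.
have dl := is_derive1_ln t0.
have dn : is_derive t 1 (fun u : R => - ln u) (- t^-1) by exact: is_deriveN.
have dc := is_derive1_comp (g := fun u : R => - ln u) dp dn.
have dM := is_deriveM (is_derive_id t 1) dc.
apply: (is_derive_eq dM); rewrite /= /GRing.scale/= mulr1.
by field; rewrite lt0r_neq0.
Qed.

Lemma dtlog_gt0 alpha t : 0 < alpha -> 0 < t < expR (- (alpha + 1)) ->
  0 < dtlog alpha t.
Proof.
move=> a0 /gt_ln_inv; rewrite /dtlog; move: (ln _) => L aL.
have L0 : 0 < L by lra.
have -> : L `^ alpha = L * L `^ (alpha - 1) by rewrite mulr_powRB1// ltW.
by rewrite -mulrBl mulr_gt0 ?powR_gt0//; lra.
Qed.

Lemma dtlog_nonincreasing alpha s t : 0 < alpha ->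
  0 < s < expR (- (alpha + 1)) -> 0 < t < expR (- (alpha + 1)) -> s <= t ->
  dtlog alpha t <= dtlog alpha s.
Proof.
move=> a0 s1 t1 st; have := gt_ln_inv _ _ s1; have := gt_ln_inv _ _ t1.
have : ln (1 / t) <= ln (1 / s).
  move: s1 t1 => /andP[s0 _] /andP[t0 _].
  by rewrite ler_ln ?posrE ?divr_gt0// ler_pM2l// lef_pV2.
rewrite /dtlog; move: (ln (1 / t)) (ln (1 / s)) => L M LM aL aM.
have L0 : 0 < L by lra.
have M0 : 0 < M by lra.
have [al1|al1] := leP 1 alpha.
  have E x : 0 < x -> x `^ alpha - alpha * x `^ (alpha - 1) =
      (x - alpha) * x `^ (alpha - 1).
    by move=> x0; rewrite mulrBl mulr_powRB1// ltW.
  rewrite !E//; apply: ler_pM; rewrite ?powR_ge0//; try lra.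
  by apply: ge0_ler_powR; rewrite ?nnegrE; lra.
apply: lerB; first by apply: ge0_ler_powR; rewrite ?nnegrE; lra.
rewrite ler_pM2l// -opprB !powRN lef_pV2 ?posrE ?powR_gt0//.
by apply: ge0_ler_powR; rewrite ?nnegrE; lra.
Qed.

(* [t * ln (1 / t) `^ alpha] is increasing only where [ln (1 / t) > alpha] and
   concave only where [ln (1 / t) >= alpha - 1]. *)
Lemma modulus_tlog alpha b : 0 < alpha -> 0 < b <= expR (- (alpha + 1)) ->
  modulus_of_continuity b (tlog alpha).
Proof.
move=> a0 /andP[b0 bE].
have E1 : expR (- (alpha + 1)) < 1 by rewrite expR_lt1; lra.
have inb t : t \in `]0, b[ -> 0 < t < expR (- (alpha + 1)).
  by rewrite in_itv/= => /andP[-> tb]; exact: lt_le_trans bE.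
have der t : t \in `]0, b[ -> is_derive t 1 (tlog alpha) (dtlog alpha t).
  move=> /inb /andP[t0 tE]; apply: is_derive_tlog.
  by rewrite t0 (lt_trans tE E1).
split => //.
- move=> t tb; have /inb/gt_ln_inv aL : t \in `]0, b[ by rewrite in_itv.
  by case/andP: tb => t0 _; rewrite mulr_gt0// powR_gt0//; lra.
- apply: gtr0_derive1_lt_oo.
  + by move=> t /der ?; apply: ex_derive.
  + move=> t tb; have ? := der _ tb; rewrite derive1E derive_val.
    exact/dtlog_gt0/inb.
  + move=> t; rewrite inE => tb; apply: differentiable_continuous.
    by apply/derivable1_diffP; have ? := der _ tb; exact: ex_derive.
- apply: (@convex_function_derive _ (\- dtlog alpha)) => [t /der ?|].
    exact: is_deriveN.
  move=> s t sb tb st; rewrite lerN2.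
  by apply: dtlog_nonincreasing; rewrite ?inb.
- set M := 2 `^ alpha * (1 + alpha) `^ alpha.
  (* The square root bound at [1 / t] gives [tlog alpha t <= M * t * Num.sqrt (1 / t) = M * Num.sqrt
     t]. *)
  apply: (@squeeze_cvgr _ _ _ _ (fun=> 0) (fun t => M * Num.sqrt t)).
  + near=> t; have t0 : 0 < t by [].
    have t1 : t < 1 by near: t; exact: nbhs_right_lt.
    rewrite /tlog mulr_ge0 ?powR_ge0 ?(ltW t0)//=.
    have h : 1 <= 1 / t by rewrite div1r invf_ge1// ltW.
    apply: le_trans.
      by apply: ler_wpM2l (powR_ln_le_sqrt _ _ a0 h); exact: ltW.
    rewrite mulrCA; apply: ler_wpM2l; first by rewrite mulr_ge0 ?powR_ge0.
    have st0 : Num.sqrt t != 0 by rewrite gt_eqF// sqrtr_gt0.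
    by rewrite div1r sqrtrV ?(ltW t0)// -{1}(sqr_sqrtr (ltW t0)) expr2 mulfK.
  + exact: cvg_cst.
  + rewrite -[X in _ --> X](mulr0 M); apply: cvgMr.
    rewrite -[X in _ --> X]sqrtr0.
    apply: cvg_at_right_filter; exact: sqrt_continuous.
Unshelve. all: by end_near. Qed.

End real.

(** * Maps with logarithmic displacement and their inverses *)

Section displacement.
Context {R : realType} {d : nat}.
Implicit Types (X Y : set 'rV[R]_d) (f g : 'rV[R]_d -> 'rV[R]_d).

(* For distinct points at distance [D >= s] in the ball of radius [r], one has
   [ln r = ln (r / D) + ln D <= ln (r / D) * (1 + ln (D / s))], and
   [(1 + ln (D / s)) `^ alpha] is at most a constant multiple of [D]. *)
Lemma homogeneous_mapping_tlog X g (alpha s b C : R) : 0 < alpha ->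
  0 < s <= 1 -> 0 < b <= expR (- 1) -> b <= s -> 0 < C ->
  (forall x y, X x -> X y -> x != y -> s <= norm2 (x - y)) ->
  (forall r x, s / b <= r -> X x -> norm2 x < r ->
    norm2 (g x - x) <= C * ln r `^ alpha) ->
  homogeneous_mapping b (tlog alpha) X g.
Proof.
move=> a0 /andP[s0 s1] /andP[b0 bE] bs C0 sep disp.
set M := (1 + alpha) `^ alpha.
have M0 : 0 < M by rewrite powR_gt0//; lra.
(* The summand 1 pays for [D] itself, the other one for the displacements of the two points. *)
exists (1 + 2 * C * M / s), 2^-1; split; [|lra|].
  by rewrite ltr_wpDr// divr_ge0 ?ltW// !mulr_gt0.
move=> r x y r0 [Xx xr] [Xy yr] xy _; set D := norm2 (y - x) => Db.
have sD : s <= D by apply: sep => //; rewrite eq_sym.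
have D0 : 0 < D by lra.
have rb : s / b <= r.
  by rewrite ler_pdivrMr//; move: Db; rewrite ltr_pdivrMr//; lra.
have L1 : 1 < ln (1 / (D / r)).
  by apply: gt_ln_inv; rewrite divr_gt0//=; exact: lt_le_trans bE.
rewrite /tlog; set L := ln _ in L1 *.
have Ds1 : 1 <= D / s by rewrite ler_pdivlMr// mul1r.
have lnr : ln r `^ alpha <= L `^ alpha * (M * (D / s)).
  apply: (@le_trans _ _ (L `^ alpha * (1 + ln (D / s)) `^ alpha)); last first.
    by rewrite ler_wpM2l ?powR_ge0// powR_ln_le.
  have l0 := ln_ge0 Ds1.
  have Dl : ln D <= ln (D / s).
    by rewrite ler_ln ?posrE ?divr_gt0// ler_pdivlMr// ler_piMr// ltW.
  have r1 : 1 <= r by apply: le_trans rb; rewrite ler_pdivlMr// mul1r.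
  have lr : ln r = L + ln D.
    by rewrite /L div1r invf_div ln_div ?posrE// subrK.
  rewrite -powRM; [|lra|lra].
  apply: ge0_ler_powR; rewrite ?nnegrE ?ln_ge0 ?(ltW a0)//.
    by rewrite mulr_ge0//; lra.
  by rewrite lr; nra.
have LP : 1 <= L `^ alpha.
  by have := ler_powR (ltW L1) (ltW a0); rewrite powRr0.
have : norm2 (g y - g x) <= norm2 (g y - y) + (D + norm2 (g x - x)).
  rewrite [norm2 (g x - x)]norm2B.
  apply: (le_trans (ler_dist2D y _ _)); rewrite lerD2l.
  exact: ler_dist2D.
have := disp _ _ rb Xx xr; have := disp _ _ rb Xy yr.
have -> : (1 + 2 * C * M / s) * r * (D / r * L `^ alpha) =
  D * L `^ alpha + 2 * (C * (L `^ alpha * (M * (D / s)))).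
  by field; rewrite !lt0r_neq0.
have h1 : D <= D * L `^ alpha by rewrite ler_peMr// ltW.
have h2 : C * ln r `^ alpha <= C * (L `^ alpha * (M * (D / s))).
  by rewrite ler_pM2l.
by lra.
Qed.

(* The logarithmic displacement is eventually at most half the norm, so the
   preimage of a point of the ball of radius [r] has norm less than [2 * r]. *)
Lemma pinv_displacement X Y f (alpha r0 C : R) : set_bij X Y f -> 0 < alpha ->
  0 < C ->
  (forall r x, r0 <= r -> X x -> norm2 x < r ->
    norm2 (f x - x) <= C * ln r `^ alpha) ->
  exists r1 C' : R, 0 < C' /\ forall r y, r1 <= r -> Y y -> norm2 y < r ->
    norm2 ('pinv_(fun=> 0) X f y - y) <= C' * ln r `^ alpha.
Proof.
move=> fXY a0 C0 disp.
(* With this slope the displacement bound at radius [2 * norm2 x] is at most [norm2 x / 2]. *)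
have e0 : 0 < (4 * C)^-1 by rewrite invr_gt0; lra.
have [r2 r21 sub] := powR_ln_sublinear _ _ a0 e0.
exists (2 + `|r0| + r2), (C * 2 `^ alpha).
split; first by rewrite mulr_gt0 ?powR_gt0.
move=> r y rr Yy yr.
have r0r : r0 <= r by have := ler_norm r0; have := normr_ge0 r0; lra.
have r2r : r2 <= r by have := normr_ge0 r0; lra.
have r2' : 2 <= r by have := normr_ge0 r0; lra.
have [_ _ fsurj] : set_bij X Y f := fXY.
have Xx : X ('pinv_(fun=> 0) X f y).
  by have [h _ _] := bijpinv_bij (fun=> 0) fXY; apply: h.
have fx : f ('pinv_(fun=> 0) X f y) = y.
  by apply: (surjpK _ fsurj); rewrite inE.
move: Xx fx; set x := 'pinv_(fun=> 0) X f y => Xx fx.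
have x2r : norm2 x < 2 * r.
  rewrite ltNge; apply/negP => xr.
  (* The radius [2 * norm2 x] strictly exceeds [norm2 x]. The bounds give
     [norm2 x <= norm2 y + norm2 x / 2], so [norm2 x < 2 * r], a contradiction. *)
  have d1 : norm2 (f x - x) <= C * ln (2 * norm2 x) `^ alpha.
    by apply: disp => //; lra.
  have d2 : C * ln (2 * norm2 x) `^ alpha <= C * ((4 * C)^-1 * (2 * norm2 x)).
    by rewrite ler_pM2l// sub//; lra.
  have e : C * ((4 * C)^-1 * (2 * norm2 x)) = norm2 x / 2.
    by field; rewrite lt0r_neq0.
  have := ler_norm2D (f x) (x - f x).
  by rewrite addrC subrK norm2B fx; rewrite fx in d1; lra.
rewrite -fx norm2B; apply: (le_trans (disp (2 * r) _ _ Xx x2r)); first lra.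
rewrite -mulrA ler_pM2l// -powRM// ?ln_ge0//; try lra.
apply: ge0_ler_powR; rewrite ?nnegrE ?ln_ge0 ?(ltW a0)//; try lra.
  by rewrite mulr_ge0 ?ln_ge0//; lra.
rewrite lnM ?posrE//; try lra.
have : ln 2 <= ln r by rewrite ler_ln ?posrE//; lra.
by lra.
Qed.

End displacement.

Theorem proposition1p3 (R : realType) (d : nat) (hd : (2 <= d)%N)
    (alpha0 : R) (halpha0 : 0 < alpha0)
    (X : set 'rV[R]_d) (hX : separated_net X)
    (hirr : forall (b : R) (w : R -> R), modulus_of_continuity b w ->
      (exists a : R, 0 < a /\
         forall t : R, 0 < t < a -> t < b -> w t = t * (ln (1 / t)) `^ alpha0) ->
      irregular_wrt b w X (integer_lattice R d))
    (f : 'rV[R]_d -> 'rV[R]_d) (hf : set_bij X (integer_lattice R d) f) :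
  limf_esup
    (fun r : R => ereal_sup
      [set (norm2 (f x - x) / (ln r) `^ alpha0)%:E | x in @ball2 R d r `&` X])
    (pinfty_nbhs R) = +oo%E.
Proof.
(* A limsup below [+oo] provides a neighbourhood [V] of infinity, containing all reals above [A], on
   which the supremum [S] is not [+oo]. *)
apply/eqP/negPn/negP; rewrite -ltey => /ereal_inf_lt[_ [V [A [_ AV]] <-]].
set S := ereal_sup _ => Soo.
have [C C0 SC] : exists2 C : R, 0 < C & (S <= C%:E)%E.
  exists (1 + `|fine S|); first by rewrite ltr_pwDl.
  case: (S) Soo => [c|//|_]; last exact: leNye.
  by move=> _; rewrite lee_fin/=; have := ler_norm c; lra.
(* The threshold puts [r] in [V] and makes [ln r] positive, so the quotient can be cleared. *)
have disp r x : 2 + `|A| <= r -> X x -> norm2 x < r ->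
    norm2 (f x - x) <= C * ln r `^ alpha0.
  move=> Ar Xx xr; have Ar' : A < r by have := ler_norm A; lra.
  have r1 : 1 < r by have := normr_ge0 A; lra.
  rewrite -ler_pdivrMr ?powR_gt0 ?ln_gt0// -lee_fin.
  apply: (le_trans _ SC); apply: le_trans (ereal_sup_ubound _); last first.
    by exists r => //; exact: AV.
  by apply: ereal_sup_ubound; exists x.
have [r1 [C' [C'0 disp']]] := pinv_displacement _ _ _ _ _ _ hf halpha0 C0 disp.
have [_ [s [_ s0 sepX _]]] := hX.
(* A common separation constant for [X] and the lattice. *)
pose s1 := Num.min s 1.
have s10 : 0 < s1 <= 1 by rewrite lt_min s0 ltr01 ge_min lexx orbT.
case/andP: (s10) => s1gt0 s1le1.
pose M := 2 + `|A| + `|r1|.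
have M1 : 1 <= M by rewrite /M; have := normr_ge0 A; have := normr_ge0 r1; lra.
(* The first bound makes [tlog alpha0] a modulus on ]0, b[; the second gives [M <= s1 / b], beyond
   the thresholds of both displacement bounds. *)
pose b := Num.min (expR (- (alpha0 + 1))) (s1 / M).
have b0 : 0 < b by rewrite lt_min expR_gt0 divr_gt0//; lra.
have bE : b <= expR (- (alpha0 + 1)) by rewrite ge_min lexx.
have bE1 : 0 < b <= expR (- 1).
  by rewrite b0 (le_trans bE)// ler_expR; lra.
have bM : b <= s1 / M by rewrite ge_min lexx orbT.
have bs : b <= s1 by rewrite (le_trans bM)// ler_pdivrMr ?ler_peMr//; lra.
have Mb : M <= s1 / b.
  by rewrite ler_pdivlMr// mulrC -ler_pdivlMr//; lra.
apply: (hirr b (tlog alpha0)).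
- by apply: modulus_tlog; rewrite ?b0.
- by exists 1.
exists f; split => //.
- apply: (@homogeneous_mapping_tlog _ _ _ _ _ s1 _ C) => //.
    by move=> x y Xx Xy xy; rewrite ge_min sepX.
  move=> r x rb; apply: disp.
  by move: Mb; rewrite /M; have := normr_ge0 r1; lra.
- apply: (@homogeneous_mapping_tlog _ _ _ _ _ s1 _ C') => //.
    move=> x y Yx Yy xy; rewrite ge_min.
    by rewrite integer_lattice_separated ?orbT.
  move=> r x rb; apply: disp'.
  by move: Mb; rewrite /M; have := normr_ge0 A; have := ler_norm r1; lra.
Qed.
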